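(* Let $\Theta\subseteq\mathbb{R}$ be an interval and let $g:\Theta\to\mathbb{R}$ be a differentiable function such that the equation $g(\theta)=0$, $\theta\in\Theta$, has a unique root $\theta^*$, with $g(\theta)>0$ for all $\theta<\theta^*$ and $g(\theta)<0$ for all $\theta>\theta^*$ ($\theta\in\Theta$). Let $b$ be a function with $g'(\theta)\ge b(\theta)$ for all $\theta\in\Theta$, and let $$U(\theta|\theta^{(t)})=g(\theta^{(t)})+\int_{\theta^{(t)}}^{\theta}b(z)\,dz,\qquad\theta,\theta^{(t)}\in\Theta.$$ Then the US iteration $$\theta^{(t+1)}=h(\theta^{(t)}),\qquad h(\theta^{(t)}):=\text{the solution in }\theta\in\Theta\text{ of }U(\theta|\theta^{(t)})=0,$$ holds a linear convergence rate given by $$\lim_{t\to\infty}\frac{|\theta^{(t+1)}-\theta^*|}{|\theta^{(t)}-\theta^*|}=|h'(\theta^* )|=\left|1-\frac{g'(\theta^* )}{b(\theta^* )}\right|=1-\frac{g'(\theta^* )}{b(\theta^* )}\in[0,1).$$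
   Context: The function $b$ is called the first-derivative lower bound (FLB) function for $g$. The iteration starts from an initial value $\theta^{(0)}\in\Theta$. The rate of convergence of the iteration $\theta^{(t+1)}=h(\theta^{(t)})$ is defined as $\lim_{t\to\infty}|\theta^{(t+1)}-\theta^*|/|\theta^{(t)}-\theta^*|$, which is identified with $|h'(\theta^* )|$ through the Taylor expansion $h(\theta^{(t)})=h(\theta^* )+(\theta^{(t)}-\theta^* )h'(\theta^* )+\tfrac12(\theta^{(t)}-\theta^* )^2h''(\tilde\theta)$ with $\tilde\theta$ between $\theta^{(t)}$ and $\theta^*$.
   Formalization: The formal statement additionally assumes g'(θ* ) ≠ 0 and that b is continuous at θ*; without these the claim fails (e.g. g = −θ³, b = −3θ²−1 gives rate 1). It also takes b Riemann integrable on Θ and θ^(0) ≠ θ*. *)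

(* Defs.v *)
From Stdlib Require Export Reals.
From Coquelicot Require Export Coquelicot.
Open Scope R_scope.

(* Any interval: open, closed or half-open, bounded or not.  Functions on Theta
   are total functions R -> R used only at points of Theta; derivatives and
   continuity are relative to Theta ([D_in], [continue_in]), i.e. the usual
   ones at interior points and one-sided ones at endpoints belonging to Theta. *)
Definition interval (Theta : R -> Prop) : Prop :=
  forall x y z : R, Theta x -> Theta z -> x <= y <= z -> Theta y.

(* U(theta | t); [RInt] is the oriented Riemann integral. *)
Definition U (g b : R -> R) (theta t : R) : R := g t + RInt b t theta.

(* [h] sends every t in Theta to the solution in Theta of U( . | t) = 0. *)
Definition US_map (Theta : R -> Prop) (g b h : R -> R) : Prop :=
  forall t : R, Theta t ->
    unique (fun theta => Theta theta /\ U g b theta t = 0) (h t).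

(* Main.v *)
(* Integrating the FLB inequality b <= g' shows that U( . | t) changes sign
   between t and the root, so h t lies between them and the errors are
   nonincreasing.  Expanding g (t) + RInt b t (h t) = 0 to first order at the root, with
   |h t - t| <= |t - ths|, gives h'(ths) = 1 - g'(ths) / b(ths).  Since b need
   not be continuous away from ths, the integrated inequality comes from Riemann sums
   tagged at mean-value points of g. *)
Require Import Defs.
From Stdlib Require Import Reals Lra Lia Classical_Prop IndefiniteDescription.
From Coquelicot Require Import Coquelicot.
From mathcomp Require Import ssrbool seq.
Open Scope R_scope.

(** * Points between two given points *)

Lemma interval_between (Theta : R -> Prop) (x y z : R) :
  interval Theta -> Theta x -> Theta y -> Rmin x y <= z <= Rmax x y -> Theta z.
Proof.
  intros HI Hx Hy Hz.
  destruct (Rle_dec x y).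
  - rewrite Rmin_left, Rmax_right in Hz by lra. exact (HI x z y Hx Hy Hz).
  - rewrite Rmin_right, Rmax_left in Hz by lra. exact (HI y z x Hy Hx Hz).
Qed.

Lemma between_dist (x y z : R) :
  Rmin x y <= z <= Rmax x y -> Rabs (z - y) <= Rabs (x - y).
Proof.
  unfold Rmin, Rmax; destruct (Rle_dec x y); intros; split_Rabs; lra.
Qed.

(** Any point [x] other than [p] makes [p] an accumulation point of the segment from [x] to [p].
    This is what lets a derivative relative to [Theta] be tested at [p], where its definition might
    otherwise be vacuous. *)
Lemma exists_between_near (x p e : R) :
  x <> p -> 0 < e ->
  exists y, Rmin x p <= y <= Rmax x p /\ y <> p /\ Rabs (y - p) < e.
Proof.
  intros Hx He.
  assert (Hd : 0 < Rabs (x - p)) by (apply Rabs_pos_lt; lra).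
  assert (Hm1 := Rmin_l (Rabs (x - p)) (e / 2)).
  assert (Hm2 := Rmin_r (Rabs (x - p)) (e / 2)).
  assert (Hm0 : 0 < Rmin (Rabs (x - p)) (e / 2)) by (apply Rmin_glb_lt; lra).
  set (m := Rmin (Rabs (x - p)) (e / 2)) in *; clearbody m.
  destruct (Rle_dec x p).
  - rewrite Rmin_left, Rmax_right by lra. exists (p - m). split_Rabs; lra.
  - rewrite Rmin_right, Rmax_left by lra. exists (p + m). split_Rabs; lra.
Qed.

(** * Relative continuity, clamping and the mean value theorem *)

Lemma continue_in_eps (f : R -> R) (D : R -> Prop) (x : R) :
  continue_in f D x -> forall e, 0 < e ->
  exists d, 0 < d /\ forall y, D y -> Rabs (y - x) < d -> Rabs (f y - f x) < e.
Proof.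
  intros H e He. destruct (H e He) as [d [Hd Hf]].
  exists d; split; [exact Hd|]. intros y Hy Hyx.
  (* [continue_in] is a punctured limit, so [y = x] is treated apart. *)
  destruct (Req_dec y x) as [->|Hn].
  - rewrite Rminus_diag, Rabs_R0; exact He.
  - apply Hf. repeat split; auto.
Qed.

(* [MVT_gen] and [IVT_cor] want two-sided continuity at the endpoints, whereas
   our functions are only controlled on Theta: precompose them with [clamp]. *)
Definition clamp (x y z : R) : R := Rmax x (Rmin y z).

Lemma clamp_in (x y z : R) : x <= y -> x <= clamp x y z <= y.
Proof. unfold clamp, Rmax, Rmin; intros; repeat destruct Rle_dec; lra. Qed.

Lemma clamp_id (x y z : R) : x <= z <= y -> clamp x y z = z.
Proof. unfold clamp, Rmax, Rmin; intros; repeat destruct Rle_dec; lra. Qed.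

Lemma clamp_lip (x y z w : R) :
  Rabs (clamp x y z - clamp x y w) <= Rabs (z - w).
Proof.
  unfold clamp, Rmax, Rmin; repeat destruct Rle_dec; split_Rabs; lra.
Qed.

Lemma continuity_clamp (f : R -> R) (D : R -> Prop) (x y : R) :
  x <= y -> (forall z, x <= z <= y -> D z) ->
  (forall z, x <= z <= y -> continue_in f D z) ->
  continuity (fun z => f (clamp x y z)).
Proof.
  intros Hxy HD Hf z e He.
  destruct (continue_in_eps f D _ (Hf _ (clamp_in x y z Hxy)) e He)
    as [d [Hd Hfd]].
  exists d; split; [exact Hd|]. intros w [_ Hw]. simpl in Hw |- *.
  unfold Rdist in *. apply Hfd.
  - apply HD, clamp_in, Hxy.
  - apply Rle_lt_trans with (2 := Hw), clamp_lip.
Qed.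

Lemma MVT_in (Theta : R -> Prop) (g dg : R -> R) (x y : R) :
  interval Theta -> (forall z, Theta z -> D_in g dg Theta z) ->
  Theta x -> Theta y -> x <= y ->
  exists c, x <= c <= y /\ g y - g x = dg c * (y - x).
Proof.
  intros HI Hg Hx Hy Hxy.
  assert (HT : forall z, x <= z <= y -> Theta z)
    by (intros z Hz; exact (HI x z y Hx Hy Hz)).
  destruct (MVT_gen (fun z => g (clamp x y z)) x y dg) as [c [Hc E]].
  - rewrite Rmin_left, Rmax_right by lra. intros z Hz.
    apply is_derive_Reals. intros e He.
    destruct (Hg z (HT z ltac:(lra)) e He) as [d [Hd Hgd]].
    (* This radius also keeps [z + k] inside the segment from [x] to [y], where [clamp] is the
       identity. *)
    assert (Hp : 0 < Rmin d (Rmin (z - x) (y - z)))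
      by (repeat apply Rmin_glb_lt; lra).
    exists (mkposreal _ Hp). simpl. intros k Hk0 Hk.
    assert (H1 := Rmin_l d (Rmin (z - x) (y - z))).
    assert (H2 := Rmin_r d (Rmin (z - x) (y - z))).
    assert (H3 := Rmin_l (z - x) (y - z)).
    assert (H4 := Rmin_r (z - x) (y - z)).
    assert (Hzk : x <= z + k <= y) by (split_Rabs; lra).
    rewrite !clamp_id by lra.
    specialize (Hgd (z + k)). simpl in Hgd. unfold Rdist in Hgd.
    replace (z + k - z) with k in Hgd by ring.
    apply Hgd. repeat split; [apply HT; lra|lra|lra].
  - intros z _. apply (continuity_clamp g Theta x y Hxy HT).
    intros w Hw. apply (cont_deriv g dg), Hg, HT, Hw.
  - rewrite Rmin_left, Rmax_right in Hc by lra.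
    rewrite !clamp_id in E by lra. exists c; auto.
Qed.

(** * Integration of the FLB inequality *)

Lemma Riemann_sum_le_increment (b g : R -> R) (xi : R -> R -> R) (P : list R) :
  (forall i, (S i < size P)%nat ->
     b (xi (nth 0 P i) (nth 0 P (S i))) * (nth 0 P (S i) - nth 0 P i)
       <= g (nth 0 P (S i)) - g (nth 0 P i)) ->
  P <> nil ->
  Riemann_sum b (SF_seq_f2 xi P) <= g (last 0 P) - g (head 0 P).
Proof.
  induction P as [|u P IH]; intros H HP; [now elim HP|].
  destruct P as [|v P].
  - simpl. unfold Riemann_sum; simpl. unfold zero; simpl. lra.
  (* The first cell is split off; its bound and the inductive one telescope. *)
  - rewrite SF_cons_f2, Riemann_sum_cons by (simpl; lia).
    assert (H0 := H 0%nat ltac:(simpl; lia)). simpl in H0.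
    assert (IH' := IH (fun i Hi => H (S i) ltac:(simpl in *; lia)) ltac:(easy)).
    unfold plus, scal in *; simpl in *. unfold mult in *; simpl in *. lra.
Qed.

(** The derivative [dg] may fail to be Riemann integrable, so [b <= dg] cannot simply be integrated.
    But the Riemann sums of the integrable [b] converge whatever the tags, and with mean-value tags
    each of them is at most [g y - g x]. *)
Lemma RInt_le_increment (Theta : R -> Prop) (g dg b : R -> R) (x y : R) :
  interval Theta -> (forall z, Theta z -> D_in g dg Theta z) ->
  (forall z, Theta z -> b z <= dg z) ->
  Theta x -> Theta y -> x <= y -> ex_RInt b x y ->
  RInt b x y <= g y - g x.
Proof.
  intros HI Hg Hb Hx Hy Hxy Hint.
  destruct (Rle_lt_or_eq_dec x y Hxy) as [Hlt| <-].
  2:{ rewrite RInt_point. unfold zero; simpl. lra. }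
  (* The tag must be defined for every pair and lie in every ordered cell, but it has to be a
     mean-value point only for cells inside the segment from [x] to [y]; elsewhere the left end
     serves. *)
  assert (Hxi : forall p : R * R, exists c,
    (fst p <= snd p -> fst p <= c <= snd p) /\
    (x <= fst p <= snd p -> snd p <= y ->
       b c * (snd p - fst p) <= g (snd p) - g (fst p))).
  { intros [u v]; simpl.
    destruct (Rle_dec x u); [|exists u; split; intros; lra].
    destruct (Rle_dec u v); [|exists u; split; intros; lra].
    destruct (Rle_dec v y); [|exists u; split; intros; lra].
    assert (HT : forall z, x <= z <= y -> Theta z)
      by (intros z Hz; exact (HI x z y Hx Hy Hz)).
    destruct (MVT_in Theta g dg u v) as [c [Hc E]]; auto.
    - apply HT; lra.
    - apply HT; lra.
    - exists c; split; intros; [lra|]. rewrite E.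
      apply Rmult_le_compat_r; [lra|]. apply Hb, HT; lra. }
  destruct (functional_choice _ Hxi) as [xi' Hxi'].
  set (xi := fun u v => xi' (u, v)).
  apply le_epsilon. intros e He.
  destruct (RInt_correct b x y Hint (ball (RInt b x y) (mkposreal e He)))
    as [d Hd]; [now exists (mkposreal e He)|].
  (* With this [n] the uniform partition has [n + 1] cells of width [(y - x) / (n + 1) < d]. *)
  destruct (nfloor_ex ((y - x) / d)) as [n [_ Hn]].
  { apply Rle_div_r; [apply cond_pos|]; lra. }
  destruct (Riemann_fine_unif_part xi x y n) as [Hs [Hp [Hh Hl]]]; [|exact Hxy|].
  { intros u v. apply (Hxi' (u, v)). }
  assert (HR : Riemann_sum b (SF_seq_f2 xi (unif_part x y n)) <= g y - g x).
  { assert (Hlast : last 0 (unif_part x y n) = y).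
    { rewrite SF_lx_f2 in Hl by (unfold unif_part; rewrite size_mkseq; lia). exact Hl. }
    assert (HS := Riemann_sum_le_increment b g xi (unif_part x y n)).
    rewrite Hlast in HS. change (head 0 (unif_part x y n) = x) in Hh.
    rewrite Hh in HS. apply HS; [|easy].
    assert (Hw : 0 <= (y - x) / (INR n + 1)).
    { apply Rle_div_r; [|lra]. assert (H := pos_INR n); lra. }
    intros i Hi. unfold unif_part in Hi; rewrite size_mkseq in Hi.
    unfold unif_part. rewrite !nth_mkseq by (apply (introT ssrnat.leP); lia).
    assert (HN : 0 < INR n + 1) by (assert (H := pos_INR n); lra).
    assert (HiN : INR (S i) <= INR n + 1)
      by (rewrite <- S_INR; apply le_INR; lia).
    rewrite S_INR in *.
    assert (Hi0 := pos_INR i).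
    apply (Hxi' (_, _)); simpl; rewrite ?S_INR.
    - split.
      + enough (0 <= INR i * (y - x) / (INR n + 1)) by lra.
        unfold Rdiv in *. rewrite Rmult_assoc. apply Rmult_le_pos; lra.
      + unfold Rdiv in *. rewrite !Rmult_assoc. lra.
    (* Writing [y] as the end of the last cell reduces the claim to [i + 1 <= n + 1]. *)
    - replace y with (x + (INR n + 1) * ((y - x) / (INR n + 1))) at 2
        by (field; lra).
      unfold Rdiv in *. rewrite !Rmult_assoc.
      apply Rplus_le_compat_l, Rmult_le_compat_r; lra. }
  specialize (Hd (SF_seq_f2 xi (unif_part x y n))).
  rewrite Rmin_left, Rmax_right in Hd by lra.
  rewrite sign_eq_1 in Hd by lra.
  assert (Hball : ball (RInt b x y) e
     (scal 1 (Riemann_sum b (SF_seq_f2 xi (unif_part x y n))))).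
  { apply Hd; [|auto]. apply Rle_lt_trans with (1 := Hs).
    apply Rlt_div_l; [assert (H := pos_INR n); lra|].
    apply Rlt_div_l in Hn; [lra|apply cond_pos]. }
  unfold ball in Hball; simpl in Hball.
  unfold AbsRing_ball, abs, minus, plus, opp, scal in Hball; simpl in Hball.
  unfold mult in Hball; simpl in Hball.
  split_Rabs; lra.
Qed.

(** * Estimates for the integral of [b] *)

(** Used twice: [c = 0] gives a Lipschitz bound for the integral, and [c = b ths] gives its
    first-order expansion at the root. *)
Lemma RInt_approx_const (f : R -> R) (t s c M : R) :
  ex_RInt f t s -> (forall z, Rmin t s <= z <= Rmax t s -> Rabs (f z - c) <= M) ->
  Rabs (RInt f t s - c * (s - t)) <= M * Rabs (s - t).
Proof.
  assert (Hle : forall u v, u <= v -> ex_RInt f u v ->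
    (forall z, u <= z <= v -> Rabs (f z - c) <= M) ->
    Rabs (RInt f u v - c * (v - u)) <= M * (v - u)).
  { intros u v Huv Hf HM.
    replace (RInt f u v - c * (v - u)) with (RInt (fun z => minus (f z) c) u v).
    - rewrite Rmult_comm. apply abs_RInt_le_const; auto.
      apply (ex_RInt_minus f (fun _ => c)); [exact Hf|apply ex_RInt_const].
    - rewrite (RInt_minus f (fun _ => c)); [|exact Hf|apply ex_RInt_const].
      rewrite RInt_const. unfold minus, plus, opp, scal; simpl.
      unfold mult; simpl. ring. }
  intros Hf HM. destruct (Rle_dec t s) as [Hts|Hts].
  - rewrite Rmin_left, Rmax_right in HM by lra.
    rewrite (Rabs_pos_eq (s - t)) by lra. now apply Hle.
  - rewrite Rmin_right, Rmax_left in HM by lra.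
    assert (H := Hle s t ltac:(lra) (ex_RInt_swap _ _ _ Hf) HM).
    rewrite <- (opp_RInt_swap f s t) by now apply ex_RInt_swap.
    unfold opp; simpl.
    replace (- RInt f s t - c * (s - t)) with (- (RInt f s t - c * (t - s))) by ring.
    rewrite Rabs_Ropp, (Rabs_minus_sym s t), (Rabs_pos_eq (t - s)) by lra.
    exact H.
Qed.

(** A Riemann integrable function is bounded, and one bound [M] serves all subsegments. *)
Lemma RInt_Lipschitz (f : R -> R) (x y : R) :
  ex_RInt f x y ->
  exists M, 0 <= M /\ forall t s, Rmin x y <= t <= Rmax x y ->
    Rmin x y <= s <= Rmax x y -> ex_RInt f t s -> Rabs (RInt f t s) <= M * Rabs (s - t).
Proof.
  intros H. destruct (ex_RInt_ub f x y H) as [M HM].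
  exists M; split.
  { apply Rle_trans with (1 := norm_ge_0 (f x)), HM.
    split; [apply Rmin_l|apply Rmax_l]. }
  intros t s Ht Hs Hts.
  assert (HA := RInt_approx_const f t s 0 M Hts).
  rewrite Rmult_0_l, Rminus_0_r in HA. apply HA.
  intros z Hz. rewrite Rminus_0_r. apply HM. revert Ht Hs Hz.
  unfold Rmin, Rmax. repeat destruct Rle_dec; lra.
Qed.

(** * Location of the US step *)

Lemma continuity_U (Theta : R -> Prop) (g b : R -> R) (t x y : R) :
  interval Theta -> (forall u v, Theta u -> Theta v -> ex_RInt b u v) ->
  Theta t -> Theta x -> Theta y -> x <= y ->
  continuity (fun z => U g b (clamp x y z) t).
Proof.
  intros HI Hint Ht Hx Hy Hxy.
  assert (HT : forall z, x <= z <= y -> Theta z)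
    by (intros z Hz; exact (HI x z y Hx Hy Hz)).
  destruct (RInt_Lipschitz b x y (Hint x y Hx Hy)) as [M [HM0 HM]].
  rewrite Rmin_left, Rmax_right in HM by lra.
  (* The variation of [U] is at most [M] times that of its argument; the added 1 covers [M = 0]. *)
  intros z e He. exists (e / (M + 1)).
  split; [apply Rdiv_lt_0_compat; lra|].
  intros w [_ Hw]. simpl in Hw |- *. unfold Rdist, U in *.
  assert (Hcz := clamp_in x y z Hxy). assert (Hcw := clamp_in x y w Hxy).
  assert (Hl := clamp_lip x y w z).
  assert (HTz := HT _ Hcz). assert (HTw := HT _ Hcw).
  assert (HC := RInt_Chasles b t (clamp x y z) (clamp x y w)
                  (Hint _ _ Ht HTz) (Hint _ _ HTz HTw)).
  unfold plus in HC; simpl in HC. rewrite <- HC.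
  assert (HB := HM _ _ Hcz Hcw (Hint _ _ HTz HTw)).
  apply Rlt_div_r in Hw; [|lra].
  rewrite <- Rplus_assoc, Rplus_minus_l.
  assert (H1 : M * Rabs (clamp x y w - clamp x y z) <= M * Rabs (w - z))
    by (apply Rmult_le_compat_l; lra).
  assert (H2 := Rabs_pos (w - z)). nra.
Qed.

(* By the FLB inequality U( . | t) changes sign between t and the root, so its
   unique zero lies there. *)
Lemma US_map_between (Theta : R -> Prop) (g dg b h : R -> R) (ths t : R) :
  interval Theta -> (forall x, Theta x -> D_in g dg Theta x) ->
  Theta ths -> g ths = 0 ->
  (forall x, Theta x -> x < ths -> 0 < g x) ->
  (forall x, Theta x -> ths < x -> g x < 0) ->
  (forall x, Theta x -> b x <= dg x) ->
  (forall x y, Theta x -> Theta y -> ex_RInt b x y) ->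
  US_map Theta g b h -> Theta t ->
  Rmin t ths <= h t <= Rmax t ths.
Proof.
  intros HI Hg Hths H0 Hpos Hneg Hb Hint Hh Ht.
  assert (Hmm : Rmin t ths <= Rmax t ths) by apply Rminmax.
  assert (HTm : Theta (Rmin t ths)) by (apply (Rmin_case t ths Theta); auto).
  assert (HTM : Theta (Rmax t ths)) by (apply (Rmax_case t ths Theta); auto).
  destruct (IVT_cor (fun z => U g b (clamp (Rmin t ths) (Rmax t ths) z) t)
              (Rmin t ths) (Rmax t ths)) as [z [Hz Ez]]; auto.
  - apply (continuity_U Theta); auto.
  (* At [t] the value of [U] is [g t]; at the root it is [g t + RInt b t ths]. The integrated FLB
     inequality gives the latter the sign opposite to [g t], or zero. *)
  - rewrite !clamp_id by lra. unfold U.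
    destruct (Rle_dec t ths) as [Hl|Hl].
    + rewrite Rmin_left, Rmax_right, RInt_point by lra. unfold zero; simpl.
      assert (HR := RInt_le_increment Theta g dg b t ths HI Hg Hb Ht Hths Hl
                      (Hint _ _ Ht Hths)).
      assert (0 <= g t)
        by (destruct Hl as [Hl| ->]; [left; auto|rewrite H0; apply Rle_refl]).
      nra.
    + rewrite Rmin_right, Rmax_left, RInt_point by lra. unfold zero; simpl.
      assert (HR := RInt_le_increment Theta g dg b ths t HI Hg Hb Hths Ht
                      ltac:(lra) (Hint _ _ Hths Ht)).
      rewrite <- (opp_RInt_swap b ths t) by auto. unfold opp; simpl.
      assert (g t < 0) by (apply Hneg; auto; lra).
      nra.
  - rewrite clamp_id in Ez by lra.
    rewrite (proj2 (Hh t Ht) z); [exact Hz|].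
    split; [apply (interval_between Theta t ths); auto|exact Ez].
Qed.

(* Landing on the root in one step from t forces equality in the FLB inequality
   on the whole segment from t to the root. *)
Lemma US_map_landing (Theta : R -> Prop) (g dg b h : R -> R) (ths t x : R) :
  interval Theta -> (forall z, Theta z -> D_in g dg Theta z) ->
  Theta ths -> g ths = 0 ->
  (forall z, Theta z -> b z <= dg z) ->
  (forall y z, Theta y -> Theta z -> ex_RInt b y z) ->
  US_map Theta g b h -> Theta t -> h t = ths ->
  Rmin t ths <= x <= Rmax t ths -> h x = ths.
Proof.
  intros HI Hg Hths H0 Hb Hint Hh Ht Hl Hx.
  assert (HTx := interval_between Theta t ths x HI Ht Hths Hx).
  destruct (Hh t Ht) as [[_ HU] _]. rewrite Hl in HU. unfold U in HU.
  apply (proj2 (Hh x HTx) ths). split; [exact Hths|]. unfold U.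
  assert (HC := RInt_Chasles b t x ths (Hint _ _ Ht HTx) (Hint _ _ HTx Hths)).
  unfold plus in HC; simpl in HC.
  assert (HR : forall u v, Theta u -> Theta v -> u <= v ->
     RInt b u v <= g v - g u)
    by (intros u v Hu Hv Huv; apply (RInt_le_increment Theta g dg); auto).
  (* The bound [HR] is an equality on the whole segment between [t] and [ths], and it holds on the
     two pieces cut at [x]; hence it is an equality on each piece, in particular between [x] and
     [ths]. *)
  destruct (Rle_dec t ths) as [Hlt|Hlt].
  - rewrite Rmin_left, Rmax_right in Hx by lra.
    assert (H1 := HR t x Ht HTx ltac:(lra)).
    assert (H2 := HR x ths HTx Hths ltac:(lra)). lra.
  - rewrite Rmin_right, Rmax_left in Hx by lra.
    assert (H1 := HR x t HTx Ht ltac:(lra)).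
    assert (H2 := HR ths x Hths HTx ltac:(lra)).
    rewrite <- (opp_RInt_swap b x t) in HC by auto.
    rewrite <- (opp_RInt_swap b ths x) in HC |- * by auto.
    unfold opp in *; simpl in *. lra.
Qed.

(** * The derivative of [h] at the root *)

Lemma US_map_derivative (Theta : R -> Prop) (g dg b h : R -> R) (ths : R) :
  interval Theta -> D_in g dg Theta ths ->
  Theta ths -> g ths = 0 -> b ths <> 0 ->
  (forall x y, Theta x -> Theta y -> ex_RInt b x y) ->
  continue_in b Theta ths -> US_map Theta g b h ->
  (forall t, Theta t -> Rmin t ths <= h t <= Rmax t ths) ->
  D_in h (fun _ => 1 - dg ths / b ths) Theta ths.
Proof.
  intros HI Hg Hths H0 Hb0 Hint Hbc Hh Hbt e He.
  assert (Hhths : h ths = ths).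
  { assert (H := Hbt ths Hths). rewrite Rmin_left, Rmax_left in H; lra. }
  assert (HB : 0 < Rabs (b ths)) by now apply Rabs_pos_lt.
  (* The two errors [E1] and [E2] add up to at most [2 * e' * Rabs (t - ths)], and [2 * e'] is half
     of [e * Rabs (b ths)], which leaves the final inequality strict. *)
  set (e' := e * Rabs (b ths) / 4).
  assert (He' : 0 < e') by (unfold e'; nra).
  destruct (continue_in_eps b Theta ths Hbc e' He') as [d1 [Hd1 Hb1]].
  destruct (Hg e' He') as [d2 [Hd2 Hg2]].
  exists (Rmin d1 d2); split; [now apply Rmin_glb_lt|].
  intros t [[Ht Hne] Hd]. simpl in Hd |- *. unfold Rdist in *.
  assert (Hda := Rlt_le_trans _ _ _ Hd (Rmin_l d1 d2)).
  assert (Hdb := Rlt_le_trans _ _ _ Hd (Rmin_r d1 d2)).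
  rewrite Hhths.
  assert (Hs := Hbt t Ht). destruct (Hh t Ht) as [[HTs HU] _].
  set (s := h t) in *. unfold U in HU.
  assert (Hp : 0 < Rabs (t - ths)) by (apply Rabs_pos_lt; lra).
  assert (E1 : Rabs (g t - dg ths * (t - ths)) <= e' * Rabs (t - ths)).
  { assert (H := Hg2 t ltac:(repeat split; auto)).
    simpl in H; unfold Rdist in H. rewrite H0 in H.
    replace (g t - dg ths * (t - ths))
      with (((g t - 0) / (t - ths) - dg ths) * (t - ths)) by (field; lra).
    rewrite Rabs_mult. apply Rmult_le_compat_r; lra. }
  assert (Hst : Rabs (s - t) <= Rabs (t - ths)).
  { revert Hs. unfold Rmin, Rmax; destruct Rle_dec; intros; split_Rabs; lra. }
  assert (E2 : Rabs (RInt b t s - b ths * (s - t)) <= e' * Rabs (t - ths)).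
  { apply Rle_trans with (e' * Rabs (s - t)).
    - apply RInt_approx_const; [auto|]. intros z Hz.
      assert (Hz' : Rmin t ths <= z <= Rmax t ths).
      { revert Hs Hz. unfold Rmin, Rmax; repeat destruct Rle_dec; lra. }
      left; apply Hb1.
      + apply (interval_between Theta t ths); auto.
      + apply Rle_lt_trans with (2 := Hda), between_dist, Hz'.
    - apply Rmult_le_compat_l; lra. }
  (* Since [g t + RInt b t s = 0], the deviation of the difference quotient is exactly the sum of
     the two expansion errors, divided by [- b ths * (t - ths)]. *)
  replace ((s - ths) / (t - ths) - (1 - dg ths / b ths))
    with (- ((g t - dg ths * (t - ths)) + (RInt b t s - b ths * (s - t)))
            / (b ths * (t - ths))).
  2:{ replace (g t) with (- RInt b t s) by lra. field. split; [exact Hb0|lra]. }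
  rewrite Rabs_div by (apply Rmult_integral_contrapositive; split; lra).
  rewrite Rabs_Ropp, Rabs_mult.
  apply Rlt_div_l; [now apply Rmult_lt_0_compat|].
  apply Rle_lt_trans with (1 := Rabs_triang _ _).
  apply Rle_lt_trans with (2 * e' * Rabs (t - ths)); [lra|].
  assert (0 < e * (Rabs (b ths) * Rabs (t - ths)))
    by (repeat apply Rmult_lt_0_compat; assumption).
  unfold e'. simpl in *. lra.
Qed.

(** * Convergence of the iterates and of the error ratios *)

(** Along an orbit that avoids the fixed point, the error ratio is the absolute value of the
    difference quotient of [f] at [p]. *)
Lemma D_in_ratio_lim (D : R -> Prop) (f df : R -> R) (p : R) (u : nat -> R) :
  D_in f df D p -> f p = p -> (forall n, D (u n) /\ u n <> p) ->
  is_lim_seq u p -> (forall n, u (S n) = f (u n)) ->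
  is_lim_seq (fun n => Rabs (u (S n) - p) / Rabs (u n - p)) (Rabs (df p)).
Proof.
  intros Hf Hp Hu Hl HS.
  apply is_lim_seq_ext with (fun n => Rabs ((f (u n) - f p) / (u n - p))).
  { intros n. rewrite Hp, HS. apply Rabs_div. destruct (Hu n); lra. }
  apply (is_lim_seq_abs _ (df p)). apply is_lim_seq_spec. intros e.
  destruct (Hf e (cond_pos e)) as [d [Hd Hfd]].
  apply is_lim_seq_spec in Hl. destruct (Hl (mkposreal d Hd)) as [N HN].
  exists N. intros n Hn. destruct (Hu n). apply Hfd.
  repeat split; auto. apply HN, Hn.
Qed.

(* The normalised errors (th n - ths) / (th 0 - ths) decrease to a limit; then
   |g (th n)| = |RInt b (th n) (th (S n))| tends to 0, so the limit point is a
   zero of g. *)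
Lemma US_iteration_lim (Theta : R -> Prop) (g dg b h : R -> R) (ths : R)
    (th : nat -> R) :
  interval Theta -> (forall x, Theta x -> D_in g dg Theta x) ->
  unique (fun x => Theta x /\ g x = 0) ths ->
  (forall x y, Theta x -> Theta y -> ex_RInt b x y) ->
  US_map Theta g b h ->
  (forall t, Theta t -> Rmin t ths <= h t <= Rmax t ths) ->
  Theta (th 0%nat) -> th 0%nat <> ths -> (forall n, th (S n) = h (th n)) ->
  is_lim_seq th ths.
Proof.
  intros HI Hg [[Hths H0] Huniq] Hint Hh Hbt Ht0 Hne HS.
  set (a := th 0%nat) in *.
  assert (Hbetw : forall n, Rmin a ths <= th n <= Rmax a ths).
  { induction n as [|n IH].
    - split; [apply Rmin_l|apply Rmax_l].
    - rewrite HS. assert (HT := interval_between Theta a ths _ HI Ht0 Hths IH).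
      assert (H := Hbt _ HT). revert IH H.
      unfold Rmin, Rmax; repeat destruct Rle_dec; lra. }
  assert (HT : forall n, Theta (th n))
    by (intros n; apply (interval_between Theta a ths); auto).
  (* Dividing by the initial error treats both sides of the root at once: [r] is nonincreasing with
     values between 0 and 1. *)
  set (r := fun n => (th n - ths) / (a - ths)).
  assert (Er : forall n, th n = ths + r n * (a - ths))
    by (intros n; unfold r; field; lra).
  assert (Hr : forall n, 0 <= r n <= 1 /\ r (S n) <= r n).
  { intros n. assert (H1 := Hbetw n).
    assert (H2 := Hbt _ (HT n)). rewrite <- HS in H2.
    rewrite (Er (S n)), (Er n) in H2. rewrite (Er n) in H1. revert H1 H2.
    unfold Rmin, Rmax; repeat destruct Rle_dec; intros; nra. }
  destruct (ex_finite_lim_seq_decr r 0) as [l Hl].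
  { intros n; apply Hr. }
  { intros n; apply Hr. }
  set (L := ths + l * (a - ths)).
  assert (HL : is_lim_seq th L).
  { apply is_lim_seq_ext with (fun n => ths + r n * (a - ths)).
    { intros n; now rewrite <- Er. }
    apply (is_lim_seq_plus' _ _ ths (l * (a - ths))); [apply is_lim_seq_const|].
    apply (is_lim_seq_scal_r r (a - ths) l Hl). }
  assert (Hl01 : 0 <= l <= 1).
  { split.
    - apply (is_lim_seq_le (fun _ => 0) r 0 l); auto.
      + intros n; apply Hr.
      + apply is_lim_seq_const.
    - apply (is_lim_seq_le r (fun _ => 1) l 1); auto.
      + intros n; apply Hr.
      + apply is_lim_seq_const. }
  assert (HTL : Theta L).
  { apply (interval_between Theta a ths); auto. unfold L.
    unfold Rmin, Rmax; repeat destruct Rle_dec; nra. }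
  assert (HgL : is_lim_seq (fun n => g (th n)) (g L)).
  { apply is_lim_seq_spec. intros e.
    destruct (continue_in_eps g Theta L (cont_deriv _ _ _ _ (Hg L HTL)) e
                (cond_pos e)) as [d [Hd Hgd]].
    apply is_lim_seq_spec in HL. destruct (HL (mkposreal d Hd)) as [N HN].
    exists N. intros n Hn. apply Hgd; [apply HT|apply HN, Hn]. }
  destruct (RInt_Lipschitz b a ths (Hint _ _ Ht0 Hths)) as [M [_ HM]].
  assert (Hg0 : is_lim_seq (fun n => g (th n)) 0).
  { apply is_lim_seq_abs_0.
    apply is_lim_seq_le_le with (fun _ => 0) (fun n => M * Rabs (th (S n) - th n)).
    - intros n; split; [apply Rabs_pos|].
      destruct (Hh _ (HT n)) as [[_ HU] _]. unfold U in HU.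
      rewrite <- HS in HU.
      replace (g (th n)) with (- RInt b (th n) (th (S n))) by lra.
      rewrite Rabs_Ropp. apply HM; auto.
    - apply is_lim_seq_const.
    - replace (Finite 0) with (Rbar_mult M 0) by (simpl; now rewrite Rmult_0_r).
      apply is_lim_seq_scal_l. apply -> is_lim_seq_abs_0.
      replace (Finite 0) with (Finite (L - L)) by (f_equal; ring).
      apply is_lim_seq_minus'; [|exact HL].
      apply is_lim_seq_incr_1 in HL. exact HL. }
  assert (EgL : g L = 0).
  { apply is_lim_seq_unique in HgL. apply is_lim_seq_unique in Hg0.
    rewrite HgL in Hg0. now injection Hg0. }
  now rewrite (Huniq L (conj HTL EgL)).
Qed.

(** * Sign and vanishing of relative derivatives *)

(** A positive derivative would make the difference quotient positive near [p], against the sign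
    change of [g]. The point [a] ensures that [p] is not isolated in [Theta]. *)
Lemma derivative_at_root_le0 (Theta : R -> Prop) (g dg : R -> R) (p a : R) :
  interval Theta -> D_in g dg Theta p -> Theta p -> g p = 0 ->
  (forall x, Theta x -> x < p -> 0 < g x) ->
  (forall x, Theta x -> p < x -> g x < 0) ->
  Theta a -> a <> p -> dg p <= 0.
Proof.
  intros HI Hg Hp H0 Hpos Hneg Ha Hne.
  apply Rnot_lt_le. intros Hd.
  destruct (Hg _ Hd) as [d [Hd0 Hgd]].
  destruct (exists_between_near a p d Hne Hd0) as [x [Hx [Hxp Hxd]]].
  assert (HTx := interval_between Theta a p x HI Ha Hp Hx).
  specialize (Hgd x ltac:(repeat split; auto)).
  simpl in Hgd. unfold Rdist in Hgd. rewrite H0 in Hgd.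
  set (q := (g x - 0) / (x - p)) in *.
  assert (Hq : g x = q * (x - p)) by (unfold q; field; lra).
  assert (Hq0 : 0 < q) by (split_Rabs; lra).
  destruct (Rle_dec x p).
  - specialize (Hpos x HTx ltac:(lra)). nra.
  - specialize (Hneg x HTx ltac:(lra)). nra.
Qed.

(** Constancy on one side of [p] is enough, since the relative derivative is already determined by
    the quotients on that side. *)
Lemma D_in_locally_const (D : R -> Prop) (f df : R -> R) (p a : R) :
  interval D -> D a -> D p -> a <> p -> D_in f df D p ->
  (forall x, Rmin a p <= x <= Rmax a p -> f x = f p) -> df p = 0.
Proof.
  intros HI Ha Hp Hne Hf Hc.
  destruct (Req_dec (df p) 0) as [H|H]; [exact H|exfalso].
  destruct (Hf (Rabs (df p)) (Rabs_pos_lt _ H)) as [d [Hd Hfd]].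
  destruct (exists_between_near a p d Hne Hd) as [x [Hx [Hxp Hxd]]].
  assert (HTx := interval_between D a p x HI Ha Hp Hx).
  specialize (Hfd x ltac:(repeat split; auto)).
  simpl in Hfd. unfold Rdist in Hfd.
  rewrite (Hc x Hx), Rminus_diag in Hfd. unfold Rdiv in Hfd.
  rewrite Rmult_0_l, Rminus_0_l, Rabs_Ropp in Hfd. lra.
Qed.

(** * The linear rate *)

Theorem theorem2 (Theta : R -> Prop) (g dg b h : R -> R) (ths : R)
    (th : nat -> R)
    (hTheta : interval Theta)
    (hg : forall x : R, Theta x -> D_in g dg Theta x)
    (hroot : unique (fun x => Theta x /\ g x = 0) ths)
    (hpos : forall x : R, Theta x -> x < ths -> 0 < g x)
    (hneg : forall x : R, Theta x -> ths < x -> g x < 0)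
    (hdg : dg ths <> 0)
    (hFLB : forall x : R, Theta x -> b x <= dg x)
    (hbint : forall x y : R, Theta x -> Theta y -> ex_RInt b x y)
    (hbcont : continue_in b Theta ths)
    (hh : US_map Theta g b h)
    (hth0 : Theta (th 0%nat))
    (hth0_neq : th 0%nat <> ths)
    (hthS : forall t : nat, th (S t) = h (th t)) :
  exists dh : R,
    D_in h (fun _ => dh) Theta ths /\
    is_lim_seq (fun t => Rabs (th (S t) - ths) / Rabs (th t - ths)) (Rabs dh) /\
    Rabs dh = Rabs (1 - dg ths / b ths) /\
    Rabs (1 - dg ths / b ths) = 1 - dg ths / b ths /\
    0 <= 1 - dg ths / b ths < 1.
Proof.
  destruct (proj1 hroot) as [Hths H0].
  assert (Hdg : dg ths < 0).
  { enough (dg ths <= 0) by lra.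
    apply (derivative_at_root_le0 Theta g dg ths (th 0%nat)); auto. }
  assert (Hb : b ths <= dg ths) by auto.
  assert (Hbt : forall t, Theta t -> Rmin t ths <= h t <= Rmax t ths)
    by (intros t Ht; apply (US_map_between Theta g dg b); auto).
  assert (Hhths : h ths = ths).
  { assert (H := Hbt ths Hths). rewrite Rmin_left, Rmax_left in H; lra. }
  assert (HD : D_in h (fun _ => 1 - dg ths / b ths) Theta ths)
    by (apply (US_map_derivative Theta g dg b h); auto; lra).
  assert (H01 : 0 <= 1 - dg ths / b ths < 1).
  (* As [b ths <= dg ths < 0], the quotient lies in the half-open interval from 0 (excluded) to 1
     (included). *)
  { assert (E : dg ths / b ths = (- dg ths) / (- b ths)) by (field; lra).
    assert (0 < (- dg ths) / (- b ths)) by (apply Rdiv_lt_0_compat; lra).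
    assert ((- dg ths) / (- b ths) <= 1) by (apply Rle_div_l; lra).
    lra. }
  exists (1 - dg ths / b ths).
  split; [exact HD|]. split; [|rewrite (Rabs_pos_eq _ (proj1 H01)); auto].
  assert (HT : forall n, Theta (th n)).
  { induction n as [|n IH]; [exact hth0|]. rewrite hthS. apply (hh _ IH). }
  destruct (classic (exists n, th n = ths)) as [[n Hn]|Hn].
  - (* The ratio is eventually 0 / 0 = 0, so here h'(ths) = 0 is needed. *)
    assert (Hland : exists m, th m <> ths /\ th (S m) = ths).
    { clear - hth0_neq Hn. induction n as [|n IH]; [easy|].
      destruct (Req_dec (th n) ths); [auto|now exists n]. }
    destruct Hland as [m [Hm HSm]].
    (* The step from [th m] lands on the root, so [h] equals [ths] on the whole segment between them
       and its derivative at [ths] vanishes. *)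
    rewrite (D_in_locally_const Theta h (fun _ => 1 - dg ths / b ths) ths (th m)); auto.
    + rewrite Rabs_R0.
      apply is_lim_seq_ext_loc with (fun _ => 0); [|apply is_lim_seq_const].
      assert (Hstay : forall k, (n <= k)%nat -> th k = ths).
      { intros k Hk. induction Hk as [|k Hk IH]; [exact Hn|].
        now rewrite hthS, IH. }
      exists n. intros k Hk. rewrite (Hstay (S k)) by lia.
      rewrite Rminus_diag, Rabs_R0. unfold Rdiv. ring.
    + intros x Hx. rewrite Hhths.
      apply (US_map_landing Theta g dg b h ths (th m)); auto.
      now rewrite <- hthS.
  - apply (D_in_ratio_lim Theta h (fun _ => 1 - dg ths / b ths)); auto.
    + intros n; split; [apply HT|]. intros E; apply Hn; now exists n.
    + apply (US_iteration_lim Theta g dg b h); auto.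
Qed.
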